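(* Blink (as defined in the context) satisfies Integrity: in every execution, no correct server triggers $\langle con.\mathrm{Decide}\rangle$ more than once.
   Context: **Model.** $f\ge 0$ is an integer; $\Pi$ is a fixed, commonly known set of $n=5f+1$ servers, of which at most $f$ are faulty (Byzantine: may behave arbitrarily and collude); the others are correct and follow the algorithm. Any two servers (including a server and itself) communicate via reliable, authenticated, FIFO links, with message delays bounded by an unknown constant $\Delta$. Event handlers execute atomically. $\mathbb B=\{\mathtt{True},\mathtt{False}\}$. **Binary Consensus** (instance $dep$): every correct server proposes one value via $\langle dep.\mathrm{Propose}\mid p\rangle$, $p\in\mathbb B$, and may trigger $\langle dep.\mathrm{Decide}\mid d\rangle$, $d\in\mathbb B$. Integrity: no correct server decides more than once. Agreement: no two correct servers decide different values. Termination: if every correct server proposes, every correct server eventually decides. Validity: a decided value was proposed by at least one correct server. **Blink** (instance $con$, built on one Binary Consensus instance $dep$). Every correct server triggers $\langle con.\mathrm{Propose}\mid\cdot\rangle$ exactly once. Each server keeps a map $suggestions$ from $\Pi$ to $\mathbb B$ (initially empty) and flags $proposed=decided=\mathtt{False}$. (i) Upon $\langle con.\mathrm{Propose}\mid v\rangle$: send $[\mathtt{Suggest},v]$ to every server. (ii) Upon delivering $[\mathtt{Suggest},v]$ from $\sigma\in\Pi$: set $suggestions[\sigma]=v$. (iii) Upon $|suggestions|\ge 4f+1$ (number of keys) and $proposed=\mathtt{False}$: pick $v$ with $|\{\pi: suggestions[\pi]=v\}|\ge 2f+1$, trigger $\langle dep.\mathrm{Propose}\mid v\rangle$, set $proposed=\mathtt{True}$.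 (iv) Upon existence of $v$ with $|\{\pi: suggestions[\pi]=v\}|\ge 4f+1$: if $decided=\mathtt{False}$, trigger $\langle con.\mathrm{Decide}\mid v\rangle$ and set $decided=\mathtt{True}$. (v) Upon $\langle dep.\mathrm{Decide}\mid v\rangle$: if $decided=\mathtt{False}$, trigger $\langle con.\mathrm{Decide}\mid v\rangle$ and set $decided=\mathtt{True}$. *)

(* Defs.v *)
From HB Require Import structures.
From mathcomp Require Import all_boot all_order all_algebra.
From mathcomp Require Import reals.

Set Implicit Arguments.
Unset Strict Implicit.
Unset Printing Implicit Defensive.

Import Order.TTheory GRing.Theory Num.Theory.

(* Consensus properties, for an interface observed on a trace: [prop p n] and
   [dec p n] are the lists of values server p has proposed, resp. decided,
   during the first n steps. C is the set of correct servers. *)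

Definition history (server : finType) := server -> nat -> seq bool.

Definition integrity (server : finType) (C : {set server})
    (dec : history server) : Prop :=
  forall p, p \in C -> forall n, size (dec p n) <= 1.

Definition agreement (server : finType) (C : {set server})
    (dec : history server) : Prop :=
  forall p q, p \in C -> q \in C ->
  forall m n v w, v \in dec p m -> w \in dec q n -> v = w.

Definition termination (server : finType) (C : {set server})
    (prop dec : history server) : Prop :=
  (forall p, p \in C -> exists n v, v \in prop p n) ->
  forall p, p \in C -> exists n v, v \in dec p n.

Definition validity (server : finType) (C : {set server})
    (prop dec : history server) : Prop :=
  forall p, p \in C -> forall n v, v \in dec p n ->
  exists2 q, q \in C & exists m, v \in prop q m.

Definition binary_consensus (server : finType) (C : {set server})
    (prop dec : history server) : Prop :=
  [/\ integrity C dec, agreement C dec,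
      termination C prop dec & validity C prop dec].

(* [Garbage k] stands for anything else a faulty server may send. *)
Inductive message := Suggest of bool | Garbage of nat.

Inductive event (server : finType) :=
| OnConPropose of bool
| OnDeliver of server & message
| OnSuggestions of bool    (* 4f+1 suggestions received; the value picked *)
| OnSupermajority of bool  (* a value supported by 4f+1 suggestions *)
| OnDepDecide of bool
| Idle.                    (* stuttering, or spontaneous faulty activity *)

Inductive action (server : finType) :=
| Send of server & message
| DepPropose of bool
| ConDecide of bool.

Arguments OnConPropose {server}.
Arguments OnSuggestions {server}.
Arguments OnSupermajority {server}.
Arguments OnDepDecide {server}.
Arguments Idle {server}.
Arguments DepPropose {server}.
Arguments ConDecide {server}.

Record local_state (server : finType) := LocalState {
  suggestions : {ffun server -> option bool}; (* None: not a key *)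
  proposed : bool;
  decided : bool
}.

Definition initial_state (server : finType) : local_state server :=
  LocalState [ffun=> None] false false.

Definition nb_keys (server : finType) (s : local_state server) : nat :=
  #|[set p | suggestions s p != None]|.

Definition support (server : finType) (s : local_state server) (v : bool) : nat :=
  #|[set p | suggestions s p == Some v]|.

Definition enough_suggestions (server : finType) (f : nat)
    (s : local_state server) : bool :=
  (4 * f + 1 <= nb_keys s) && ~~ proposed s.

Definition supermajority (server : finType) (f : nat)
    (s : local_state server) (v : bool) : bool :=
  4 * f + 1 <= support s v.

Definition enabled (server : finType) (f : nat) (s : local_state server)
    (e : event server) : bool :=
  match e with
  | OnSuggestions v => enough_suggestions f s && (2 * f + 1 <= support s v)
  | OnSupermajority v => supermajority f s v
  | _ => true
  end.

Definition try_decide (server : finType) (s : local_state server) (v : bool) :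
    local_state server * seq (action server) :=
  if decided s then (s, [::])
  else (LocalState (suggestions s) (proposed s) true, [:: ConDecide v]).

(* The atomic execution of a handler of the algorithm: new local state and
   actions triggered, in order. *)
Definition handle (server : finType) (s : local_state server)
    (e : event server) : local_state server * seq (action server) :=
  match e with
  | OnConPropose v => (s, [seq Send p (Suggest v) | p <- enum server])
  | OnDeliver p (Suggest v) =>
      (LocalState [ffun q => if q == p then Some v else suggestions s q]
                  (proposed s) (decided s), [::])
  | OnDeliver _ (Garbage _) => (s, [::])
  | OnSuggestions v =>
      (LocalState (suggestions s) true (decided s), [:: DepPropose v])
  | OnSupermajority v => try_decide s v
  | OnDepDecide v => try_decide s v
  | Idle => (s, [::])
  end.

(* At step i, at real time [time i], server [actor i] undergoes [occurs i] and
   triggers the actions [triggers i]; [state i p] is the local state of p just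
   before step i. Finite executions are padded with [Idle] steps. *)
Record execution (server : finType) (R : realType) := Execution {
  time : nat -> R;
  actor : nat -> server;
  occurs : nat -> event server;
  triggers : nat -> seq (action server);
  state : nat -> server -> local_state server
}.

Definition events_at (server : finType) (R : realType)
    (x : execution server R) (p : server) (n : nat) : seq (event server) :=
  [seq occurs x i | i <- iota 0 n & actor x i == p].

Definition actions_at (server : finType) (R : realType)
    (x : execution server R) (p : server) (n : nat) : seq (action server) :=
  flatten [seq triggers x i | i <- iota 0 n & actor x i == p].

Definition sent (server : finType) (R : realType) (x : execution server R)
    (p q : server) (n : nat) : seq message :=
  pmap (fun a => if a is Send r m then if r == q then Some m else None
                 else None) (actions_at x p n).

Definition delivered (server : finType) (R : realType)
    (x : execution server R) (p q : server) (n : nat) : seq message :=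
  pmap (fun e => if e is OnDeliver r m then if r == p then Some m else None
                 else None) (events_at x q n).

Definition dep_proposals (server : finType) (R : realType)
    (x : execution server R) : history server := fun p n =>
  pmap (fun a => if a is DepPropose v then Some v else None) (actions_at x p n).

Definition dep_decisions (server : finType) (R : realType)
    (x : execution server R) : history server := fun p n =>
  pmap (fun e => if e is OnDepDecide v then Some v else None) (events_at x p n).

Definition con_decisions (server : finType) (R : realType)
    (x : execution server R) : history server := fun p n =>
  pmap (fun a => if a is ConDecide v then Some v else None) (actions_at x p n).

(* Reliable, authenticated, FIFO links with delays at most Delta. On each link,
   what is delivered up to and including step n is, in order, an initial
   segment of what was sent strictly before step n (the rest, [transit], is in
   flight): nothing is forged, duplicated or reordered. Everything sent up to
   step n is delivered within Delta. *)
Definition good_links (server : finType) (R : realType) (Delta : R)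
    (x : execution server R) : Prop :=
  forall p q n,
    (exists transit, sent x p q n = delivered x p q n.+1 ++ transit) /\
    (exists m, (time x m <= time x n + Delta)%R /\
               size (sent x p q n.+1) <= size (delivered x p q m.+1)).

Definition follows_blink (server : finType) (f : nat) (R : realType)
    (x : execution server R) (p : server) : Prop :=
  state x 0 p = initial_state server /\
  forall i,
    if actor x i == p then
      enabled f (state x i p) (occurs x i) /\
      (state x i.+1 p, triggers x i) = handle (state x i p) (occurs x i)
    else state x i.+1 p = state x i p.

(* The two handlers guarded by the local state are not postponed forever:
   executing them falsifies the conditions below, so these may not hold from
   some step on. (Running [OnSupermajority] again after having decided is
   allowed, but has no effect.) *)
Definition fair (server : finType) (f : nat) (R : realType)
    (x : execution server R) (p : server) : Prop :=
  forall i,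
    (exists2 j, i <= j & ~~ enough_suggestions f (state x j p)) /\
    (exists2 j, i <= j &
       ~~ ([exists v, supermajority f (state x j p) v]
           && ~~ decided (state x j p))).

Definition proposes_once (server : finType) (R : realType)
    (x : execution server R) (p : server) : Prop :=
  exists! i, actor x i = p /\ exists v, occurs x i = OnConPropose v.

(* The steps of the servers outside C, the faulty ones, are constrained only by
   the links: they may undergo any event and trigger any actions. *)
Definition blink_execution (server : finType) (f : nat) (C : {set server})
    (R : realType) (Delta : R) (x : execution server R) : Prop :=
  [/\ forall i j, i <= j -> (time x i <= time x j)%R,
      good_links Delta x,
      forall p, p \in C ->
        [/\ follows_blink f x p, fair f x p & proposes_once x p]
    & binary_consensus C (dep_proposals x) (dep_decisions x)].

(* Main.v *)
Require Import Defs.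
From mathcomp Require Import all_boot all_order all_algebra.
From mathcomp Require Import reals.

(** The flag [decided] of a correct server counts its decisions: [ConDecide] is triggered only by a
    handler that finds the flag down and raises it, and no handler lowers it. Summing this balance
    ([decisions_handle]) over the steps shows that the number of decisions is the flag read as 0 or
    1 ([size_con_decisions]), hence at most 1. *)

Definition decisions {server : finType} (s : seq (action server)) : seq bool :=
  pmap (fun a => if a is ConDecide v then Some v else None) s.

(** Only [try_decide] emits [ConDecide], exactly when it raises the flag. Reading booleans as
    numbers makes the equation telescope over steps. *)
Lemma decisions_handle (server : finType) (s : local_state server)
    (e : event server) :
  decided s + size (decisions (handle s e).2) = decided (handle s e).1.
Proof.
case: e => [v|q [v|k]|v|v|v|] /=; rewrite ?addn0 //.
(* Broadcasting to any list of recipients yields no decision. *)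
- by elim: (enum server) => [|q r IHr] //=; rewrite addn0.
- by case: s => ? ? [].
- by case: s => ? ? [].
Qed.

Lemma con_decisionsS (server : finType) (R : realType)
    (x : execution server R) (p : server) (n : nat) :
  con_decisions x p n.+1 =
  con_decisions x p n ++
    (if actor x n == p then decisions (triggers x n) else [::]).
Proof.
rewrite /con_decisions /actions_at -addn1 iotaD filter_cat map_cat flatten_cat.
by rewrite pmap_cat /=; case: ifP => //= _; rewrite cats0.
Qed.

(** An equality, since the bound by 1 alone is not inductive: it would not rule out a further
    decision. *)
Lemma size_con_decisions (f : nat) (server : finType) (R : realType)
    (x : execution server R) (p : server) (n : nat) :
  follows_blink f x p ->
  size (con_decisions x p n) = decided (state x n p).
Proof.
move=> [init step]; elim: n => [|n IHn]; first by rewrite init.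
rewrite con_decisionsS size_cat IHn; have := step n.
case: ifP => _ => [[_ h]|->]; last by rewrite addn0.
have [-> ->] : state x n.+1 p = (handle (state x n p) (occurs x n)).1 /\
               triggers x n = (handle (state x n p) (occurs x n)).2.
  by rewrite -h.
exact: decisions_handle.
Qed.

Theorem theorem3 (f : nat) (server : finType) (faulty : {set server})
    (R : realType) (Delta : R) (x : execution server R) :
  #|server| = 5 * f + 1 ->
  #|faulty| <= f ->
  blink_execution f (~: faulty) Delta x ->
  integrity (~: faulty) (con_decisions x).
Proof.
move=> _ _ [_ _ correct _] p pC n.
have [blink_p _ _] := correct p pC.
by rewrite (size_con_decisions f server R x p n) // leq_b1.
Qed.
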